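(* Let $\mathcal{A}$ be a finite alphabet and let $\mathcal{F}\subseteq\mathcal{A}^+_{\mathbb{Z}}$ be a non-trivial set of connected patterns. If $k\ge1$ is an integer and $\beta$ is a positive real number such that $$|\mathcal{A}|-\sum_{f\in\mathcal{F}}\beta^{1-|f|}>\beta+k-1,$$ then there exists a real number $\beta'>k$ such that $$|\mathcal{A}|-\sum_{f\in\mathcal{F}}(\beta')^{1-|f|}\ge\beta'.$$ (Each inequality includes the convergence of the sum in it.)
   Context: A pattern over $\mathbb{Z}$ is an element $p\in\mathcal{A}^S$ where $S\subseteq\mathbb{Z}$ is non-empty and finite; its size is $|p|=|S|$; $\mathcal{A}^+_{\mathbb{Z}}$ is the set of all patterns. A pattern is connected if its support is an interval $\{i,i+1,\ldots,j\}$ with $i\le j$. A set of patterns is non-trivial if it contains at least one pattern of size at least $2$. *)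

(* Defs.v *)
From HB Require Import structures.
From mathcomp Require Import all_boot all_order all_algebra finmap.
From mathcomp Require Import classical_sets reals constructive_ereal esum.
Set Implicit Arguments.
Unset Strict Implicit.
Unset Printing Implicit Defensive.
Import Order.TTheory GRing.Theory Num.Theory.
Local Open Scope fset_scope.
Local Open Scope ring_scope.

(* A finite map [p : {fmap int -> A}] is a finite set [domf p] together with a
   function from [domf p] to [A], that is, an element of A^S with S = domf p. *)
Definition pattern (A : finType) := {p : {fmap int -> A} | domf p != fset0}.
HB.instance Definition _ (A : finType) := Choice.on (pattern A).

Definition supp (A : finType) (p : pattern A) : {fset int} := domf (val p).

Definition psize (A : finType) (p : pattern A) : nat := #|` supp p|.

Definition connected_pattern (A : finType) (p : pattern A) : Prop :=
  exists i j : int, i <= j /\ forall n : int, (n \in supp p) = (i <= n <= j).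

Definition nontrivial (A : finType) (F : set (pattern A)) : Prop :=
  exists2 p : pattern A, F p & (2 <= psize p)%N.

(* The exponent 1 - |f| is an integer, usually negative. *)
Definition weight (R : realType) (A : finType) (beta : R) (f : pattern A) : R :=
  beta ^ (1 - (psize f)%:Z).

(* Main.v *)
Require Import Defs.
From mathcomp Require Import all_boot all_order all_algebra finmap.
From mathcomp Require Import classical_sets reals constructive_ereal esum.
From mathcomp Require Import cardinality fsbigop ereal lra.
Set Implicit Arguments.
Unset Strict Implicit.
Unset Printing Implicit Defensive.
Import Order.TTheory GRing.Theory Num.Theory.
Local Open Scope ring_scope.

(* If [beta > 1], take [beta' = beta + k - 1], since the sum is nonincreasing
   in [beta].  If [beta <= 1], every weight is at least [1], so a finite
   [X `<=` F] containing a pattern of size at least [2] has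
   [sum >= #|X| - 1 + 1 / beta]; as [beta + 1 / beta >= 2], the hypothesis gives
   [#|A| > k + #|X|], hence [#|A| >= (k + 1) + #|X|] by integrality, and
   [beta' = k + 1] works because its weights are at most [1]. *)

(** An extended sum of nonnegative terms is a supremum over finite subsets, so uniform bounds on
    finite sums suffice. With [fset_sum_le_esum], this keeps all estimates among finite real
    sums. *)
Lemma esum_EFin_le (R : realType) (T : choiceType) (D : set T) (u : T -> R)
    (M : R) :
  (forall X : {fset T}, {subset X <= D} -> \sum_(x <- X) u x <= M) ->
  (\esum_(x in D) (u x)%:E <= M%:E)%E.
Proof.
move=> le_M; apply: ge_ereal_sup => _ /= [X [finX XD] <-].
rewrite fsbig_finite//= sumEFin lee_fin; apply: le_M => x.
by rewrite in_fset_set// !inE; exact: XD.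
Qed.

Lemma fset_sum_le_esum (R : realType) (T : choiceType) (D : set T) (u : T -> R)
    (X : {fset T}) :
  {subset X <= D} -> ((\sum_(x <- X) u x)%:E <= \esum_(x in D) (u x)%:E)%E.
Proof.
move=> XD; apply: esum_ge; exists [set` X]%classic.
  by split; [exact: finite_fset | move=> x /= /XD; rewrite inE].
by rewrite -fsbig_seq ?fset_uniq//= sumEFin.
Qed.

Lemma psize_gt0 (A : finType) (p : pattern A) : (0 < psize p)%N.
Proof. by rewrite /psize cardfs_gt0; exact: (valP p). Qed.

(** Supports are non-empty, so the truncated [.-1] is exact; natural powers of [b^-1] make
    monotonicity in [b] immediate. *)
Lemma weightE (R : realType) (A : finType) (b : R) (f : pattern A) :
  weight b f = b^-1 ^+ (psize f).-1.
Proof.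
rewrite /weight -[in LHS](prednK (psize_gt0 f)) -addn1 PoszD opprD addrCA subrr.
by rewrite addr0 -exprz_inv.
Qed.

Lemma weight_ge0 (R : realType) (A : finType) (b : R) (f : pattern A) :
  0 <= b -> 0 <= weight b f.
Proof. by move=> b_ge0; rewrite weightE exprn_ge0// invr_ge0. Qed.

Lemma le_weight (R : realType) (A : finType) (b c : R) (f : pattern A) :
  0 < b -> b <= c -> weight c f <= weight b f.
Proof.
move=> b_gt0 bc; have c_gt0 := lt_le_trans b_gt0 bc.
by rewrite !weightE lerXn2r ?nnegrE ?invr_ge0 ?(ltW b_gt0) ?(ltW c_gt0) ?lef_pV2.
Qed.

Lemma weight1 (R : realType) (A : finType) (f : pattern A) :
  weight 1 f = 1 :> R.
Proof. by rewrite weightE invr1 expr1n. Qed.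

Lemma weight_geV (R : realType) (A : finType) (b : R) (f : pattern A) :
  0 < b <= 1 -> (2 <= psize f)%N -> b^-1 <= weight b f.
Proof.
case/andP=> b_gt0 b_le1; rewrite weightE; case: psize => [|[|n]]//= _.
by rewrite ler_eXnr// invf_ge1.
Qed.

Lemma ler2_addV (R : realType) (b : R) : 0 < b -> 2 <= b + b^-1.
Proof.
move=> b_gt0; have bV : b * b^-1 = 1 by rewrite divff ?gt_eqF.
have : 0 <= (b - 1) ^+ 2 * b^-1 by rewrite mulr_ge0 ?sqr_ge0 ?invr_ge0 ?ltW.
(* The products [b * b^-1] stay unreduced, so the identity is polynomial in [b] and [b^-1]. *)
have -> : (b - 1) ^+ 2 * b^-1 = b * (b * b^-1) - 2 * (b * b^-1) + b^-1 by lra.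
by rewrite bV; lra.
Qed.

(** The pattern [p] contributes at least [b^-1], hence at least [2 - b], and every other one at
    least 1. The bound is kept linear in [b], so that [b] later cancels. *)
Lemma sum_weight_ge (R : realType) (A : finType) (b : R) (p : pattern A)
    (X : {fset pattern A}) :
  0 < b <= 1 -> p \in X -> (2 <= psize p)%N ->
  #|` X|%:R + 1 - b <= \sum_(f <- X) weight b f.
Proof.
move=> b01 pX p_ge2; have /andP[b_gt0 b_le1] := b01.
rewrite (big_fsetD1 p)//= (cardfsD1 p) pX add1n -natr1.
have := weight_geV b01 p_ge2; have := ler2_addV b_gt0.
have : #|` (X `\ p)%fset|%:R <= \sum_(f <- (X `\ p)%fset) weight b f.
  rewrite -sum1_size natr_sum ler_sum// => f _.
  by rewrite -[leLHS](weight1 R f) le_weight.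
by lra.
Qed.

Theorem lemma20 (R : realType) (A : finType) (F : set (pattern A))
  (hconn : forall f : pattern A, F f -> connected_pattern f)
  (hnt : nontrivial F)
  (k : nat) (hk : (1 <= k)%N) (beta : R) (hbeta : 0 < beta)
  (hsum : summable F (fun f => (weight beta f)%:E))
  (hineq : ((beta + k%:R - 1)%:E <
            (#|A|%:R)%:E - \esum_(f in F) (weight beta f)%:E)%E) :
  exists beta' : R,
    [/\ k%:R < beta',
        summable F (fun f => (weight beta' f)%:E) &
        (beta'%:E <= (#|A|%:R)%:E - \esum_(f in F) (weight beta' f)%:E)%E].
Proof.
have finite_lt (X : {fset pattern A}) : {subset X <= F} ->
    \sum_(f <- X) weight beta f < #|A|%:R - (beta + k%:R - 1).
  move=> /(fset_sum_le_esum (weight beta)) leX; rewrite ltrBrDl -ltrBrDr.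
  by rewrite -lte_fin [X in (_ < X)%E]EFinB (lt_le_trans hineq)// leeB.
(* A uniform bound on finite sums yields both summability and the inequality at [b']. *)
suff [b' kb' finite_le] : exists2 b' : R, k%:R < b' &
    forall X : {fset pattern A}, {subset X <= F} ->
      \sum_(f <- X) weight b' f <= #|A|%:R - b'.
  have b'_ge0 : 0 <= b' by rewrite (le_trans _ (ltW kb')).
  have le_esum := esum_EFin_le finite_le; exists b'; split=> //.
    rewrite /summable (eq_esum (b := fun f => (weight b' f)%:E)).
      exact: le_lt_trans le_esum (ltry _).
    by move=> f _; rewrite /= ger0_norm// weight_ge0.
  apply: (le_trans _ (leeB (lexx _) le_esum)).
  by rewrite -EFinB lee_fin subKr.
have [beta_le1 | beta_gt1] := leP beta 1; last first.
  have kR : 1 <= k%:R :> R by rewrite ler1n.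
  (* This witness exceeds [k] because [beta > 1], is at least [beta] because [k >= 1], and makes the
     bound in [finite_lt] exactly [#|A| - b']. *)
  exists (beta + k%:R - 1); first by lra.
  move=> X XF; apply/ltW/(le_lt_trans _ (finite_lt X XF)).
  by apply: ler_sum => f _; apply: le_weight => //; lra.
case: hnt => p Fp p_ge2; exists k.+1%:R; first by rewrite ltr_nat.
(* [X] may lack a pattern of size at least 2, so [p] is adjoined before [sum_weight_ge] is
   applied. *)
move=> X XF; pose Y := (p |` X)%fset.
have YF : {subset Y <= F}.
  by move=> f; rewrite in_fset1U => /orP[/eqP->|/XF//]; rewrite inE.
have pY : p \in Y by rewrite !inE eqxx.
have b01 : 0 < beta <= 1 by rewrite hbeta.
have /(le_lt_trans (sum_weight_ge b01 pY p_ge2)) := finite_lt Y YF.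
(* The terms [- beta] cancel, leaving a strict inequality between naturals, which gains the unit
   needed for [k.+1]. *)
move=> card_lt; have : (k + #|` Y| < #|A|)%N.
  by rewrite -(ltr_nat R) natrD; lra.
rewrite -(ler_nat R) -addSn natrD => card_le.
suff : \sum_(f <- X) weight k.+1%:R f <= #|` Y|%:R :> R by lra.
apply: (@le_trans _ _ #|` X|%:R).
  rewrite -sum1_size natr_sum ler_sum// => f _.
  by rewrite -[leRHS](weight1 R f) le_weight// ler1n.
by rewrite ler_nat fsubset_leq_card ?fsubsetUr.
Qed.
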